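(* Let $G$ be a compact connected Lie group with Lie algebra $\mathfrak g$ and bi-invariant Riemannian metric $\langle\cdot,\cdot\rangle$. If $(x,Y,\mu,\xi)$ is a solution curve in $G\times\mathfrak g\times\mathfrak g^*\times\mathfrak g^*$ of the system $$\dot x=T_eL_xY,\qquad \dot Y=X_\xi,\qquad \dot\mu=0,\qquad \dot\xi=-\mu+\mathrm{ad}^*_Y\xi, \qquad (\mathrm{H})$$ then $(x,Y)$ is a solution of $$Y=T_xL_{x^{-1}}\dot x,\qquad \dddot{Y}+[Y,\ddot Y]=0. \qquad (\mathrm{EL})$$ Conversely, if $(x,Y)$ is a solution of $(\mathrm{EL})$ and $\xi,\mu$ are curves in $\mathfrak g^*$ satisfying $\dot Y=X_\xi$ and $\dot X_\xi+X_\mu+\mathrm{ad}_YX_\xi=0$, then $(x,Y,\mu,\xi)$ is a solution of $(\mathrm{H})$.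
   Context: $L_x$ is left translation by $x$; $\mathrm{ad}_YZ=[Y,Z]$; $\mathrm{ad}^*_Y\xi=\xi\circ\mathrm{ad}_Y$ for $\xi\in\mathfrak g^*$ (no sign). For $\xi\in\mathfrak g^*$, $X_\xi\in\mathfrak g$ is defined by $\xi(Y)=\langle X_\xi,Y\rangle$ for all $Y\in\mathfrak g$. Dots denote derivatives of curves in the vector spaces $\mathfrak g$, $\mathfrak g^*$, and $\dot x$ is the velocity of the curve $x$ in $G$. All curves are smooth. *)

(* Defs.v *)
From HB Require Import structures.
From mathcomp Require Import all_boot all_order all_algebra.
From mathcomp Require Import all_classical all_reals all_analysis.

Set Implicit Arguments.
Unset Strict Implicit.
Unset Printing Implicit Defensive.

Import Order.TTheory GRing.Theory Num.Theory.
Import numFieldNormedType.Exports.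

Local Open Scope classical_set_scope.
Local Open Scope ring_scope.

(* The notions below are meant for finite-dimensional V and an open set U. *)
Fixpoint Ck_on (R : realType) (V W : normedModType R) (k : nat)
    (U : set V) (f : V -> W) : Prop :=
  match k with
  | 0 => forall u, U u -> {for u, continuous f}
  | k'.+1 => (forall u, U u -> differentiable f u) /\
             (forall v : V, Ck_on k' U (fun u => 'd f u v))
  end.

Definition smooth_on (R : realType) (V W : normedModType R)
    (U : set V) (f : V -> W) : Prop :=
  forall k, Ck_on k U f.

(* [chart_map] and [chart_inv] are total functions; they only matter on
   [chart_dom] and on the coordinate domain [chart_map @` chart_dom]. *)
Record chart (R : realType) (n : nat) (M : topologicalType) := Chart {
  chart_dom : set M ;
  chart_map :> M -> 'rV[R]_n ;
  chart_inv : 'rV[R]_n -> M ;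
  chart_dom_open : open chart_dom ;
  chart_img_open : open (chart_map @` chart_dom) ;
  chart_mapK : {in chart_dom, cancel chart_map chart_inv} ;
  chart_map_cts : forall x, chart_dom x -> {for x, continuous chart_map} ;
  chart_inv_cts : forall u, (chart_map @` chart_dom) u ->
    {for u, continuous chart_inv} }.

Definition chart_img (R : realType) (n : nat) (M : topologicalType)
    (c : chart R n M) : set 'rV[R]_n :=
  c @` chart_dom c.

HB.mixin Record isManifold (R : realType) (n : nat) M of Topological M := {
  atlas : set (chart R n M) ;
  atlas_cover : forall x : M, exists2 c, atlas c & chart_dom c x ;
  atlas_compat : forall c d, atlas c -> atlas d ->
    smooth_on (c @` (chart_dom c `&` chart_dom d)) (d \o chart_inv c) ;
  manifold_hausdorff : hausdorff_space M ;
  manifold_second_countable : @second_countable M }.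

#[short(type="manifoldType")]
HB.structure Definition Manifold (R : realType) (n : nat) :=
  { M of isManifold R n M & Topological M }.

Definition chart_at (R : realType) (n : nat) (M : manifoldType R n) (x : M) :
    chart R n M :=
  s2val (cid2 (atlas_cover x)).

(* The tangent space T_xM is 'rV[R]_n: a tangent vector at x is represented
   by its coordinates in the chart [chart_at x]. *)

Section Tangent.
Variables (R : realType) (n : nat).
Implicit Types M N : manifoldType R n.

Definition tangent_map M N (f : M -> N) (x : M) (v : 'rV[R]_n) : 'rV[R]_n :=
  'd (chart_at (f x) \o f \o chart_inv (chart_at x)) (chart_at x x) v.

(* the coordinates in the chart c of v in T_xM *)
Definition to_chart M (c : chart R n M) (x : M) (v : 'rV[R]_n) : 'rV[R]_n :=
  'd (c \o chart_inv (chart_at x)) (chart_at x x) v.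

(* the vector of T_xM having coordinates v in the chart c *)
Definition of_chart M (c : chart R n M) (x : M) (v : 'rV[R]_n) : 'rV[R]_n :=
  'd (chart_at x \o chart_inv c) (c x) v.

Definition velocity M (x : R -> M) (t : R) : 'rV[R]_n :=
  derive1 (fun s => chart_at (x t) (x s)) t.

Definition smooth_curve M (J : set R) (x : R -> M) : Prop :=
  (forall t, J t -> {for t, continuous x}) /\
  (forall c, atlas c -> smooth_on (J `&` x @^-1` chart_dom c) (c \o x)).

Definition vf_in_chart M (c : chart R n M) (V : M -> 'rV[R]_n)
    (u : 'rV[R]_n) : 'rV[R]_n :=
  to_chart c (chart_inv c u) (V (chart_inv c u)).

(* [V, W] = DW(V) - DV(W) in coordinates, i.e. the commutator VW - WV of
   derivations *)
Definition vf_bracket M (V W : M -> 'rV[R]_n) (x : M) : 'rV[R]_n :=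
  let c := chart_at x in
  let V' := vf_in_chart c V in
  let W' := vf_in_chart c W in
  'd W' (c x) (V' (c x)) - 'd V' (c x) (W' (c x)).

End Tangent.

Record riemannianMetric (R : realType) (n : nat) (M : manifoldType R n) :=
  RiemannianMetric {
  metric :> M -> 'rV[R]_n -> 'rV[R]_n -> R ;
  metric_sym : forall x v w, metric x v w = metric x w v ;
  metric_linear : forall x a u v w,
    metric x (a *: u + v) w = a * metric x u w + metric x v w ;
  metric_gt0 : forall x v, v != 0 -> 0 < metric x v v ;
  metric_smooth : forall c : chart R n M, atlas c -> forall v w : 'rV[R]_n,
    smooth_on (chart_img c) (fun u => let x := chart_inv c u in
      metric x (of_chart c x v) (of_chart c x w)) }.

HB.mixin Record isLieGroup (R : realType) (n : nat) G
    of Manifold R n G & Group G := {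
  mulg_cts : continuous (fun p : G * G => (p.1 * p.2)%g) ;
  mulg_smooth : forall a b c : chart R n G, atlas a -> atlas b -> atlas c ->
    smooth_on [set p : 'rV[R]_n * 'rV[R]_n | [/\ chart_img a p.1,
        chart_img b p.2 & chart_dom c (chart_inv a p.1 * chart_inv b p.2)%g]]
      (fun p : 'rV[R]_n * 'rV[R]_n => c (chart_inv a p.1 * chart_inv b p.2)%g) ;
  invg_cts : continuous (fun x : G => (x^-1)%g) ;
  invg_smooth : forall a c : chart R n G, atlas a -> atlas c ->
    smooth_on [set u | chart_img a u /\ chart_dom c ((chart_inv a u)^-1)%g]
      (fun u => c ((chart_inv a u)^-1)%g) }.

#[short(type="lieGroupType")]
HB.structure Definition LieGroup (R : realType) (n : nat) :=
  { G of isLieGroup R n G & Manifold R n G & Group G }.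

Section Lie.
Variables (R : realType) (n : nat) (G : lieGroupType R n).
Implicit Types (x y : G) (X Y Z v w : 'rV[R]_n) (xi mu : 'cV[R]_n).

Definition ltrans x : G -> G := fun y => (x * y)%g.
Definition rtrans x : G -> G := fun y => (y * x)%g.

Definition bi_invariant (m : riemannianMetric G) : Prop :=
  forall x y v w,
    m (ltrans x y) (tangent_map (ltrans x) y v) (tangent_map (ltrans x) y w)
      = m y v w /\
    m (rtrans x y) (tangent_map (rtrans x) y v) (tangent_map (rtrans x) y w)
      = m y v w.

(* The Lie algebra g = T_eG is 'rV[R]_n, and its dual is 'cV[R]_n through
   the pairing [ev]. *)

Definition left_invariant_vf Y : G -> 'rV[R]_n :=
  fun x => tangent_map (ltrans x) 1%g Y.

Definition ad Y Z : 'rV[R]_n :=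
  vf_bracket (left_invariant_vf Y) (left_invariant_vf Z) 1%g.

Definition ev xi Y : R := (Y *m xi) 0 0.

(* xi o ad_Y, given by its values on the standard basis *)
Definition coad Y xi : 'cV[R]_n := \col_i ev xi (ad Y (delta_mx 0 i)).

Definition sharp (m : riemannianMetric G) xi : 'rV[R]_n :=
  xget 0 [set X | forall Y, ev xi Y = m 1%g X Y].

Definition solution_H (m : riemannianMetric G) (J : set R)
    (x : R -> G) (Y : R -> 'rV[R]_n) (mu xi : R -> 'cV[R]_n) : Prop :=
  [/\ smooth_curve J x, smooth_on J Y, smooth_on J mu & smooth_on J xi] /\
  forall t, J t ->
    [/\ velocity x t = tangent_map (ltrans (x t)) 1%g (Y t),
        derive1 Y t = sharp m (xi t),
        derive1 mu t = 0 &
        derive1 xi t = - mu t + coad (Y t) (xi t)].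

Definition solution_EL (J : set R) (x : R -> G) (Y : R -> 'rV[R]_n) : Prop :=
  [/\ smooth_curve J x, smooth_on J Y &
  forall t, J t ->
    Y t = tangent_map (ltrans ((x t)^-1)%g) (x t) (velocity x t) /\
    derive1n 3 Y t + ad (Y t) (derive1n 2 Y t) = 0].

End Lie.

(* Main.v *)
(* The bracket of left-invariant fields is read off from the group law mu of a
   chart around the identity: with B Y Z the mixed second derivative of mu at
   (e, e) along (Y, 0) and (0, Z), one has [Y, Z] = B Y Z - B Z Y. Comparing
   left and right invariance of the metric to first order at e, and using
   symmetry of second derivatives, shows that ad_Y is skew for <.,.>. Hence
   X_(ad^*_Y xi) = - [Y, X_xi], so the last equation of (H) reads
   Y'' = - X_mu - [Y, Y']. Differentiating gives
   Y''' + [Y, Y''] = - X_(mu'), and X is an isomorphism. *)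

Require Import Defs.
From HB Require Import structures.
From mathcomp Require Import all_boot all_order all_algebra.
From mathcomp Require Import all_classical all_reals all_analysis.
From mathcomp Require Import ring lra.
Import Order.TTheory GRing.Theory Num.Theory.
Import numFieldNormedType.Exports.
Local Open Scope classical_set_scope.
Local Open Scope ring_scope.

Set Implicit Arguments.
Unset Strict Implicit.
Unset Printing Implicit Defensive.

(** * Differentials of locally equal maps, and derivatives along curves *)

Section NearEq.
Context {R : realType} {V W : normedModType R}.
Implicit Types (f g : V -> W) (x : V).

(** [g] inherits the first-order expansion of [f], because the two remainders coincide at every
    small [h]. *)
Let near_eq_diff_subproof f g x : {near x, f =1 g} -> differentiable f x ->
  g \o shift x = cst (g x) + 'd f x +o_ 0 id.
Proof.
move=> fg df; apply/eqaddoP => _/posnumP[e]; near=> h.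
have -> : (g \o shift x - (cst (g x) + 'd f x)) h =
    (f \o shift x - (cst (f x) + 'd f x)) h.
  change (g (h + x) - (g x + 'd f x h) = f (h + x) - (f x + 'd f x h)).
  rewrite (nbhs_singleton fg); congr (_ - _); apply/esym; near: h.
  by move: fg; rewrite (near_shift 0 x); apply: filterS => h; rewrite /= subr0.
near: h; have /eqaddoP De := diff_locally df; exact: De.
Unshelve. all: by end_near. Qed.

Lemma near_eq_diff f g x : {near x, f =1 g} -> differentiable f x ->
  'd g x = 'd f x :> (V -> W).
Proof.
move=> fg df; apply: diff_unique; first exact: diff_continuous.
exact: near_eq_diff_subproof.
Qed.

Lemma near_eq_differentiable f g x : {near x, f =1 g} ->
  differentiable f x -> differentiable g x.
Proof.
move=> fg df; apply/diff_locallyP; rewrite (near_eq_diff fg df).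
by split; [exact: diff_continuous | exact: near_eq_diff_subproof].
Qed.

End NearEq.

Lemma is_derive1_diff {R : realType} (W : normedModType R) (f : R -> W) t :
  differentiable f t -> is_derive t 1 f ('d f t 1).
Proof.
by move=> df; apply: DeriveDef; [exact: diff_derivable | rewrite deriveE].
Qed.

Lemma is_derive1_comp_diff {R : realType} (V W : normedModType R) (f : V -> W)
    (c : R -> V) (t : R) dc x :
  is_derive t 1 c dc -> c t = x -> differentiable f x ->
  is_derive t 1 (fun s => f (c s)) ('d f x dc).
Proof.
move=> [cd cE] <- df; have /derivable1_diffP cdf := cd.
have -> : dc = 'd c t 1 by rewrite -cE deriveE.
have <- : 'd (f \o c) t 1 = 'd f (c t) ('d c t 1) by rewrite diff_comp.
by apply: is_derive1_diff; exact: differentiable_comp.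
Qed.

Lemma is_derive1_line {R : realType} (V : normedModType R) (w a : V) (t : R) :
  is_derive t 1 (fun s => w + s *: a) a.
Proof.
have -> : (fun s : R => w + s *: a) = cst w + ( *:%R ^~ a) by [].
have sd : is_derive t 1 ( *:%R ^~ a) a.
  apply: is_derive_eq; first exact: is_derive1_diff.
  by rewrite diff_val scale1r.
by rewrite -[X in is_derive _ _ _ X]add0r; exact: is_deriveD.
Qed.

(** * Symmetry of the second derivative *)

Section Schwarz.
Context {R : realType} {V : normedModType R}.
Variables (f : V -> R) (p : V).
Hypothesis df : \forall q \near p, differentiable f q.

Let second_difference (a b : V) : R -> R := fun s =>
  f (p + s *: b + s *: a) - f (p + s *: a) - f (p + s *: b) + f p.

(** The mean value theorem along [a] turns the second difference into [s] times an increment of [g],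
    the derivative of [f] along [a]. Expanding [g] to first order at [p] leaves [s] times its
    derivative along [b]. *)
Let second_difference_expansion (a b : V) (e : R) :
  differentiable (fun q => 'd f q a) p -> 0 < e ->
  \forall s \near 0^'+, `|second_difference a b s
    - s ^+ 2 * 'd (fun q => 'd f q a) p b| <= e * s ^+ 2.
Proof.
move=> dg e0; set g := fun q => 'd f q a.
(* The two displacements have norms at most [s * (|b| + |a|)] and [s * |a|], so remainders at rate
   [e / K] add up to at most [e * s]. The summand 1 keeps [K] positive when [a] and [b] vanish. *)
set K := `|b| + `|a| + `|a| + 1.
have K0 : 0 < K by rewrite /K; have := normr_ge0 a; have := normr_ge0 b; lra.
have /eqaddoP/(_ (e / K) ltac:(exact: divr_gt0)) gE := diff_locally dg.
have : \forall h \near (0 : V), differentiable f (h + p) /\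
    `|g (h + p) - (g p + 'd g p h)| <= e / K * `|h|.
  apply: filterI; last exact: gE.
  by move: df; rewrite (near_shift 0 p); apply: filterS => h; rewrite /= subr0.
move=> /nbhs_norm0P[r /= r0 Hr].
near=> s.
have s0 : 0 < s by near: s; exact: nbhs_right_gt.
have small c : 0 <= c <= s ->
    `|c *: a| <= s * `|a| /\ `|s *: b + c *: a| <= s * (`|b| + `|a|).
  move=> /andP[c0 cs]; have ca : `|c *: a| <= s * `|a|.
    by rewrite normrZ ger0_norm// ler_wpM2r.
  split=> //; rewrite (le_trans (ler_normD _ _))// mulrDr lerD//.
  by rewrite normrZ gtr0_norm.
have sr : s * (`|b| + `|a|) < r.
  have : s < r / K by near: s; apply: nbhs_right_lt; rewrite divr_gt0.
  rewrite ltr_pdivlMr// => /(le_lt_trans _); apply; rewrite ler_pM2l//.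
  by rewrite /K; have := normr_ge0 a; lra.
have rca c : 0 <= c <= s -> `|c *: a| < r.
  move=> /small[h _]; apply: le_lt_trans sr; apply: le_trans h _.
  by rewrite ler_pM2l// lerDr.
have rsb c : 0 <= c <= s -> `|s *: b + c *: a| < r.
  by move=> /small[_ h]; exact: le_lt_trans sr.
pose phi c := f (p + s *: b + c *: a) - f (p + c *: a).
pose dphi c := g (p + s *: b + c *: a) - g (p + c *: a).
have dphiE c : 0 <= c <= s -> is_derive c 1 phi (dphi c).
  move=> cs; have [d1 _] := Hr _ (rca c cs); have [d2 _] := Hr _ (rsb c cs).
  rewrite addrC in d1; rewrite addrC addrA in d2.
  have l1 : is_derive c 1 (fun s => p + s *: a) a by exact: is_derive1_line.
  have l2 : is_derive c 1 (fun t => p + s *: b + t *: a) a.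
    by exact: is_derive1_line.
  apply: is_deriveB; first exact: (is_derive1_comp_diff l2 erefl).
  exact: (is_derive1_comp_diff l1 erefl).
have [c] : exists2 c, c \in `]0, s[%R & phi s - phi 0 = dphi c * (s - 0).
  apply: MVT => // [c|]; last first.
    by apply: derivable_within_continuous => c; rewrite in_itv /= => /dphiE.
  by rewrite in_itv /= => /andP[? ?]; apply: dphiE; rewrite !ltW.
rewrite in_itv/= subr0 => /andP[/ltW c0 /ltW cs] phiE.
have cI : 0 <= c <= s by rewrite c0.
have -> : second_difference a b s = dphi c * s.
  by rewrite -phiE /phi /second_difference !scale0r !addr0; ring.
have [_ g1] := Hr _ (rca c cI); have [_ g2] := Hr _ (rsb c cI).
have [n1 n2] := small _ cI.
have dgZ k v : 'd g p (k *: v) = k * 'd g p v by exact: linearZ.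
have dgD v w : 'd g p (v + w) = 'd g p v + 'd g p w by exact: linearD.
rewrite (addrC _ p) dgZ in g1.
rewrite (addrC _ p) addrA dgD !dgZ in g2.
(* The mean value point [c] is unknown, but [g p] and [c * 'd g p a] cancel between the two
   expansions, leaving only the two remainders. *)
have -> : dphi c * s - s ^+ 2 * 'd g p b =
  s * ((g (p + s *: b + c *: a) - (g p + (s * 'd g p b + c * 'd g p a))) -
   (g (p + c *: a) - (g p + c * 'd g p a))).
  by rewrite /dphi; ring.
rewrite normrM (gtr0_norm s0) expr2 mulrCA ler_pM2l//.
rewrite (le_trans (ler_normB _ _))//.
apply: (@le_trans _ _ (e / K * (s * (`|b| + `|a| + `|a|)))).
  rewrite [s * (_ + `|a|)]mulrDr mulrDr; apply: lerD.
    by apply: le_trans g2 _; rewrite ler_pM2l// divr_gt0.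
  by apply: le_trans g1 _; rewrite ler_pM2l// divr_gt0.
rewrite mulrCA [e * s]mulrC ler_pM2l// mulrAC ler_pdivrMr//.
by rewrite ler_pM2l// /K; lra.
Unshelve. all: by end_near. Qed.

(* Both mixed derivatives are the limit of the same second difference, which
   is symmetric in the two directions. *)
Lemma diff2_sym (a b : V) :
  differentiable (fun q => 'd f q a) p ->
  differentiable (fun q => 'd f q b) p ->
  'd (fun q => 'd f q a) p b = 'd (fun q => 'd f q b) p a.
Proof.
move=> da db; apply/eqP; rewrite -subr_eq0 -normr_le0.
apply/ler_addgt0Pr => e e0.
have e20 : 0 < e / 2 by rewrite divr_gt0.
near (0 : R)^'+ => s.
have s0 : 0 < s by near: s; exact: nbhs_right_gt.
have := near (second_difference_expansion b da e20) s => /(_ ltac:(done)) h1.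
have := near (second_difference_expansion a db e20) s => /(_ ltac:(done)) h2.
have sym : second_difference b a s = second_difference a b s.
  rewrite /second_difference -(addrA p (s *: a)) (addrC (s *: a)) addrA; ring.
rewrite sym in h2.
(* The bound is multiplied by [s ^+ 2], the scale of both expansions; each of them contributes half
   of [e]. *)
rewrite add0r -(ler_pM2l (exprn_gt0 2 s0)).
rewrite -{1}(gtr0_norm (exprn_gt0 2 s0)) -normrM mulrBr.
set A := _ * _; set B := _ * _; set D := second_difference a b s in h1 h2.
have -> : A - B = (D - B) - (D - A) by ring.
rewrite (le_trans (ler_normB _ _))//.
have -> : s ^+ 2 * e = e / 2 * s ^+ 2 + e / 2 * s ^+ 2 by field.
exact: lerD.
Unshelve. all: by end_near. Qed.

End Schwarz.

(** * Derivatives of matrix-valued and bilinear expressions *)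

Section MatrixDerivative.
Context {R : realType} {V : normedModType R}.

Lemma is_derive_mx m n (M : V -> 'M[R]_(m, n)) (t v : V) (dM : 'M[R]_(m, n)) :
  (forall i j, is_derive t v (fun x => M x i j) (dM i j)) -> is_derive t v M dM.
Proof.
move=> dE; have dM' : derivable M t v.
  by apply/derivable_mxP => i j; have [] := dE i j.
apply: DeriveDef => //; rewrite derive_mx//; apply/matrixP => i j; rewrite mxE.
by have [] := dE i j.
Qed.

Lemma is_derive_coord m n (M : V -> 'M[R]_(m, n)) (t v : V)
    (dM : 'M[R]_(m, n)) i j :
  is_derive t v M dM -> is_derive t v (fun x => M x i j) (dM i j).
Proof.
move=> [Md <-]; rewrite derive_mx// mxE; apply: DeriveDef => //.
exact: (iffLR (derivable_mxP M t v) Md).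
Qed.

Lemma is_derive_fsum n (h : 'I_n -> V -> R) (t v : V) (dh : 'I_n -> R) :
  (forall i, is_derive t v (h i) (dh i)) ->
  is_derive t v (fun x => \sum_i h i x) (\sum_i dh i).
Proof.
move=> hE; have -> : (fun x => \sum_i h i x) = \sum_i h i.
  by rewrite fct_sumE.
exact: is_derive_sum.
Qed.

Lemma is_derive_fmul (f g : V -> R) (t v : V) df dg :
  is_derive t v f df -> is_derive t v g dg ->
  is_derive t v (fun x => f x * g x) (df * g t + f t * dg).
Proof.
move=> fE gE; have fgE := is_deriveM fE gE.
have -> : df * g t + f t * dg = f t *: dg + g t *: df.
  by rewrite /GRing.scale/=; ring.
exact: fgE.
Qed.

Lemma is_derive_mulmxr m n p (M : V -> 'M[R]_(m, n)) (A : 'M[R]_(n, p))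
    (t v : V) dM :
  is_derive t v M dM -> is_derive t v (fun x => M x *m A) (dM *m A).
Proof.
move=> ME; apply: is_derive_mx => i j; rewrite mxE.
have -> : (fun x => (M x *m A) i j) = (fun x => \sum_k M x i k * A k j).
  by apply/funext => x; rewrite mxE.
apply: is_derive_fsum => k.
rewrite -[dM i k * _]addr0 -(mulr0 (M t i k)).
by apply: is_derive_fmul; exact: is_derive_coord.
Qed.

Lemma is_derive_tr m n (M : V -> 'M[R]_(m, n)) (t v : V) dM :
  is_derive t v M dM -> is_derive t v (fun x => (M x)^T) dM^T.
Proof.
move=> ME; apply: is_derive_mx => i j; rewrite mxE.
have -> : (fun x => (M x)^T i j) = (fun x => M x j i).
  by apply/funext => x; rewrite mxE.
exact: is_derive_coord.
Qed.

End MatrixDerivative.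

Section BilinearDerivative.
Context {R : realType} {V : normedModType R} {n p : nat}.

Lemma bilinear_delta_mx (W : lmodType R) (h : 'rV[R]_n -> 'rV[R]_p -> W) a b :
  (forall w, linear (h ^~ w)) -> (forall u, linear (h u)) ->
  h a b = \sum_i \sum_j (a 0 i * b 0 j) *: h (delta_mx 0 i) (delta_mx 0 j).
Proof.
move=> hl hr.
pose hlL w : {linear 'rV[R]_n -> W} :=
  HB.pack (h ^~ w) (GRing.isLinear.Build _ _ _ _ _ (hl w)).
pose hrL u : {linear 'rV[R]_p -> W} :=
  HB.pack (h u) (GRing.isLinear.Build _ _ _ _ _ (hr u)).
rewrite -[LHS]/(hlL b a) {1}(row_sum_delta a) linear_sum; apply: eq_bigr => i _.
rewrite linearZ/= -[h _ b]/(hrL (delta_mx 0 i) b).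
rewrite {1}(row_sum_delta b) linear_sum.
by rewrite scaler_sumr; apply: eq_bigr => j _; rewrite linearZ/= scalerA.
Qed.

(** Product rule for a bilinear form that itself varies. Expanding in the standard bases reduces it
    to products of three real functions. The double sum is the contribution of the varying form and
    depends on [a] and [b] only through their values at [t]. *)
Lemma is_derive_bilin_form (h : V -> 'rV[R]_n -> 'rV[R]_p -> R)
    (dh : 'rV[R]_n -> 'rV[R]_p -> R) (a : V -> 'rV[R]_n) (b : V -> 'rV[R]_p)
    (t v : V) da db :
  (forall x w, linear (h x ^~ w : _ -> R^o)) ->
  (forall x u, linear (h x u : _ -> R^o)) ->
  (forall u w, is_derive t v (fun x => h x u w) (dh u w)) ->
  is_derive t v a da -> is_derive t v b db ->
  is_derive t v (fun x => h x (a x) (b x)) (h t da (b t) + h t (a t) db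
    + \sum_i \sum_j a t 0 i * b t 0 j * dh (delta_mx 0 i) (delta_mx 0 j)).
Proof.
move=> hl hr hE aE bE.
pose e i j x := h x (delta_mx 0 i) (delta_mx 0 j).
have expand x u w : h x u w = \sum_i \sum_j u 0 i * w 0 j * e i j x.
  exact: (bilinear_delta_mx (W := R^o)).
rewrite 2!(expand t) -!big_split/=.
have -> : (fun x => h x (a x) (b x)) =
    (fun x => \sum_i \sum_j a x 0 i * b x 0 j * e i j x).
  by apply/funext => x; exact: expand.
apply: is_derive_fsum => i; rewrite -!big_split/=.
apply: is_derive_fsum => j.
have aEi := is_derive_coord 0 i aE; have bEj := is_derive_coord 0 j bE.
have eE := hE (delta_mx 0 i) (delta_mx 0 j).
apply: is_derive_eq (is_derive_fmul (is_derive_fmul aEi bEj) eE) _.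
by rewrite -/(e i j t); ring.
Qed.

End BilinearDerivative.

(** Each entry of [f] is a constant bilinear form, so the contribution of a varying form is zero. *)
Lemma is_derive_bilin_mx {R : realType} (V : normedModType R) (n p q : nat)
    (f : 'rV[R]_n -> 'rV[R]_p -> 'rV[R]_q) (a : V -> 'rV[R]_n)
    (b : V -> 'rV[R]_p) (t v : V) da db :
  (forall w, linear (f ^~ w)) -> (forall u, linear (f u)) ->
  is_derive t v a da -> is_derive t v b db ->
  is_derive t v (fun x => f (a x) (b x)) (f da (b t) + f (a t) db).
Proof.
move=> fl fr aE bE; apply: is_derive_mx => i j.
have := @is_derive_bilin_form R V n p (fun _ u w => f u w i j) (fun _ _ => 0)
  a b t v da db.
move=> /(_ _ _ _ aE bE) h; apply: is_derive_eq; first apply: h.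
- by move=> _ w k u u'; rewrite fl !mxE.
- by move=> _ u k w w'; rewrite fr !mxE.
- rewrite !mxE big1 ?addr0// => k _; rewrite big1// => l _; exact: mulr0.
Qed.

(** * Smooth maps on open sets and derivatives of smooth curves *)

Section SmoothOn.
Context {R : realType} {V W : normedModType R}.

(** Since [U] is open, [f] and [g] agree near each of its points; hence their differentials agree on
    [U], which feeds the induction. *)
Lemma eq_Ck_on k (U : set V) (f g : V -> W) : open U ->
  (forall u, U u -> f u = g u) -> Ck_on k U f -> Ck_on k U g.
Proof.
move=> Uo; elim: k f g => [|k IH] f g fg /=.
  move=> cf u Uu; have fgn : {near u, f =1 g}.
    by near=> w; apply: fg; near: w; exact: open_nbhs_nbhs.
  change (g @ u --> g u); rewrite -(fg _ Uu); apply: cvg_trans (cf u Uu).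
  exact: near_eq_cvg.
have fgn u : U u -> {near u, f =1 g}.
  by move=> Uu; near=> w; apply: fg; near: w; exact: open_nbhs_nbhs.
move=> [df cf]; split=> [u Uu|v].
  by apply: near_eq_differentiable (df u Uu); exact: fgn.
apply: IH (cf v) => u Uu; rewrite (near_eq_diff (fgn _ Uu))//; exact: df.
Unshelve. all: by end_near. Qed.

End SmoothOn.

Section SmoothCurve.
Context {R : realType} {W : normedModType R}.
Variables (J : set R) (f : R -> W).
Hypotheses (J_open : open J) (f_smooth : smooth_on J f).

Lemma smooth_on_is_derive t : J t -> is_derive t 1 f (derive1 f t).
Proof.
move=> Jt; rewrite derive1E; apply: DeriveDef => //; apply: diff_derivable.
by have [+ _] := f_smooth 1; apply.
Qed.

Lemma smooth_on_derive1 : smooth_on J (derive1 f).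
Proof.
move=> k; have [df /(_ 1)] := f_smooth k.+1.
apply: eq_Ck_on => // u Ju; rewrite derive1E'//; exact: df.
Qed.

End SmoothCurve.

Lemma smooth_on_derive1n {R : realType} (W : normedModType R) (J : set R)
    (f : R -> W) k : open J -> smooth_on J f -> smooth_on J (derive1n k f).
Proof.
move=> Jo fs; elim: k => // k IH.
by rewrite derive1nS; exact: smooth_on_derive1.
Qed.

(** * The metric and the isomorphism from the dual onto the Lie algebra *)

Section Sharp.
Context {R : realType} {n : nat} {G : lieGroupType R n}.
Variable m : riemannianMetric G.

Lemma metric_linearl x w : linear (m x ^~ w : 'rV[R]_n -> R^o).
Proof. by move=> a u v; exact: metric_linear. Qed.

Lemma metric_linearr x w : linear (m x w : 'rV[R]_n -> R^o).
Proof.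
by move=> a u v; rewrite !(Defs.metric_sym _ _ w); exact: metric_linear.
Qed.

Lemma metricBl x u v w : m x (u - v) w = m x u w - m x v w.
Proof. by rewrite addrC -scaleN1r metric_linear mulN1r addrC. Qed.

Lemma metricBr x u v w : m x w (u - v) = m x w u - m x w v.
Proof. by rewrite !(Defs.metric_sym _ _ w) metricBl. Qed.

Lemma metricNl x v w : m x (- v) w = - m x v w.
Proof. by rewrite -[- v]sub0r metricBl -(subrr v) metricBl subrr sub0r. Qed.

Lemma metric_inj x v w : (forall u, m x v u = m x w u) -> v = w.
Proof.
move=> vw; apply/eqP; rewrite -subr_eq0; apply/negP => /negP/(metric_gt0 m x).
by rewrite {1}metricBl vw subrr ltxx.
Qed.

(** Turns [sharp], which is defined by choice, into an explicit matrix product, from which linearity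
    and differentiation follow. *)
Definition gram : 'M[R]_n := \matrix_(i, j) m 1%g (delta_mx 0 i) (delta_mx 0 j).

Lemma gramE u v : m 1%g u v = (u *m gram *m v^T) 0 0.
Proof.
rewrite (bilinear_delta_mx (W := R^o) u v (metric_linearl 1%g)
  (metric_linearr 1%g)).
rewrite mxE exchange_big; apply: eq_bigr => j _; rewrite !mxE mulr_suml.
by apply: eq_bigr => i _; rewrite !mxE mulrAC.
Qed.

(** A row vector killed by [gram] is orthogonal to every vector, hence zero by definiteness. *)
Lemma gram_unit : gram \in unitmx.
Proof.
rewrite -row_free_unit.
apply: inj_row_free => v v0; apply: (@metric_inj 1%g) => u.
by rewrite !gramE v0 mul0mx !mul0mx.
Qed.

Lemma ev_inj (xi eta : 'cV[R]_n) : (forall v, ev xi v = ev eta v) -> xi = eta.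
Proof.
move=> h; apply/colP => i; have := h (delta_mx 0 i); rewrite /ev.
by rewrite -!rowE !mxE.
Qed.

Lemma metric_sharp xi v : m 1%g (sharp m xi) v = ev xi v.
Proof.
(* The default 0 of [xget] is excluded by exhibiting a representing vector, [xi^T *m invmx gram]. *)
rewrite /sharp; case: xgetP => [u -> /(_ v) //|/(_ (xi^T *m invmx gram))[]] w.
rewrite gramE mulmxKV ?gram_unit// /ev -{1}(trmxK xi) -{1}(trmxK w) -trmx_mul.
by rewrite mxE.
Qed.

Lemma sharpE xi : sharp m xi = xi^T *m invmx gram.
Proof.
apply: (@metric_inj 1%g) => v; rewrite metric_sharp gramE mulmxKV ?gram_unit//.
by rewrite /ev -{1}(trmxK xi) -{1}(trmxK v) -trmx_mul mxE.
Qed.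

Lemma sharp_inj : injective (sharp m).
Proof. by move=> xi eta e; apply: ev_inj => v; rewrite -!metric_sharp e. Qed.

Lemma sharpD xi eta : sharp m (xi + eta) = sharp m xi + sharp m eta.
Proof. by rewrite !sharpE raddfD mulmxDl. Qed.

Lemma sharpN xi : sharp m (- xi) = - sharp m xi.
Proof. by rewrite !sharpE raddfN mulNmx. Qed.

Lemma sharp0 : sharp m 0 = 0.
Proof. by rewrite sharpE raddf0 mul0mx. Qed.

Lemma is_derive_sharp (xi : R -> 'cV[R]_n) (t : R) dxi :
  is_derive t 1 xi dxi -> is_derive t 1 (fun s => sharp m (xi s)) (sharp m dxi).
Proof.
move=> h; rewrite sharpE (_ : (fun s => _) = fun s => (xi s)^T *m invmx gram).
  exact/is_derive_mulmxr/is_derive_tr.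
by apply/funext => s; rewrite sharpE.
Qed.

End Sharp.

(** * Charts and the chain rule in coordinates *)

Lemma diff_compE {R : realType} (U V W : normedModType R) (f : U -> V)
    (g : V -> W) x v :
  differentiable f x -> differentiable g (f x) ->
  'd (g \o f) x v = 'd g (f x) ('d f x v).
Proof. by move=> df dg; rewrite diff_comp. Qed.

Lemma diffPE {R : realType} (V W : normedModType R) (f g : V -> W) a x v :
  differentiable f x -> differentiable g x ->
  'd (a *: f + g) x v = a *: 'd f x v + 'd g x v.
Proof.
move=> df dg; have daf := differentiableZ a df.
by rewrite diffD// diffZ.
Qed.

Lemma near_eq_diffE {R : realType} (V W : normedModType R) (f g : V -> W) x v :
  {near x, f =1 g} -> differentiable f x -> 'd g x v = 'd f x v.
Proof. by move=> fg df; rewrite (near_eq_diff fg df). Qed.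

Lemma is_diff_pair_cst {R : realType} {V W : normedModType R} (w : W) (v : V) :
  is_diff v (fun u => (u, w)) (fun u => (u, 0)).
Proof. exact: (@is_diff_pair _ _ _ _ id id (cst w) 0). Qed.

Lemma is_diff_cst_pair {R : realType} {V W : normedModType R} (w : W) (v : V) :
  is_diff v (fun u => (w, u)) (fun u => (0, u)).
Proof. exact: (@is_diff_pair _ _ _ _ (cst w) 0 id id). Qed.

Section Charts.
Context {R : realType} {n : nat} {M : manifoldType R n}.
Implicit Types (c d : chart R n M) (x : M).

Lemma chart_at_atlas x : atlas (chart_at x).
Proof. by rewrite /chart_at; case: cid2. Qed.

Lemma chart_at_dom x : chart_dom (chart_at x) x.
Proof. by rewrite /chart_at; case: cid2. Qed.

Lemma chart_invK c x : chart_dom c x -> chart_inv c (c x) = x.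
Proof. by move=> cx; apply: chart_mapK; exact: mem_set. Qed.

Lemma chart_img_map c x : chart_dom c x -> chart_img c (c x).
Proof. by move=> cx; exists x. Qed.

Lemma chart_img_inv c u : chart_img c u ->
  chart_dom c (chart_inv c u) /\ c (chart_inv c u) = u.
Proof. by move=> [x cx <-]; rewrite chart_invK. Qed.

Lemma near_chart_img c x : chart_dom c x -> \forall u \near c x, chart_img c u.
Proof.
move=> cx; apply: open_nbhs_nbhs; split; last exact: chart_img_map.
exact: chart_img_open.
Qed.

Lemma chart_inv_continuous c x : chart_dom c x -> chart_inv c @ c x --> x.
Proof.
by move=> cx; rewrite -{2}(chart_invK cx); apply: chart_inv_cts; exists x.
Qed.

Lemma transition_differentiable c d x : atlas c -> atlas d ->
  chart_dom c x -> chart_dom d x -> differentiable (d \o chart_inv c) (c x).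
Proof.
by move=> ac ad cx dx; have [+ _] := atlas_compat c d ac ad 1; apply; exists x.
Qed.

End Charts.

Section ChainRule.
Context {R : realType} {n : nat}.

(** The two coordinate expressions agree only where [f] lands in the domain of [d]. Continuity of
    [f] at [x] makes this a neighbourhood of [c x], which suffices for the differentials. *)
Lemma diff_chart_comp (M N P : manifoldType R n) (f : M -> N) (g : N -> P) x
    (c : chart R n M) (d : chart R n N) (e : chart R n P) v :
  chart_dom c x -> chart_dom d (f x) -> {for x, continuous f} ->
  differentiable (d \o f \o chart_inv c) (c x) ->
  differentiable (e \o g \o chart_inv d) (d (f x)) ->
  'd (e \o (g \o f) \o chart_inv c) (c x) v =
  'd (e \o g \o chart_inv d) (d (f x)) ('d (d \o f \o chart_inv c) (c x) v).
Proof.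
move=> cx dfx fc df dg.
set F := d \o f \o chart_inv c in df *; set H := e \o g \o chart_inv d in dg *.
have E : d (f x) = F (c x) by rewrite /F /= chart_invK.
rewrite E in dg *.
apply: eq_trans (diff_compE v df dg).
apply: near_eq_diffE (differentiable_comp df dg).
near=> u; rewrite /H /F /= chart_invK//.
near: u; have fcx : (f \o chart_inv c) @ c x --> f x.
  exact: cvg_comp (chart_inv_continuous cx) fc.
by apply: fcx; apply: open_nbhs_nbhs; split => //; exact: chart_dom_open.
Unshelve. all: by end_near. Qed.

Lemma diff_chart_id (M : manifoldType R n) (c : chart R n M) x v :
  chart_dom c x -> 'd (c \o id \o chart_inv c) (c x) v = v.
Proof.
move=> cx; have -> : 'd (c \o id \o chart_inv c) (c x) = id :> (_ -> _).
  rewrite (@near_eq_diff _ _ _ id) ?diff_val//.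
  near=> u => /=; have /chart_img_inv[_ ->//] : chart_img c u.
  by near: u; exact: near_chart_img.
by [].
Unshelve. all: by end_near. Qed.

(** The chain rule for the identity of [M], read from [c] to [chart_at x] and back. *)
Lemma to_chartK (M : manifoldType R n) (c : chart R n M) x v :
  atlas c -> chart_dom c x -> to_chart c x (of_chart c x v) = v.
Proof.
move=> ac cx; rewrite /to_chart /of_chart.
have xa := chart_at_atlas x; have xd := chart_at_dom x.
by rewrite -(@diff_chart_comp M M M id id) ?(diff_chart_id)//;
  exact: transition_differentiable.
Qed.

End ChainRule.

(** * Left and right translations in coordinates *)

Section Translations.
Context {R : realType} {n : nat} {G : lieGroupType R n}.
Implicit Types x y : G.

Lemma ltrans_continuous x : continuous (ltrans x).
Proof.
move=> y; apply: (@continuous_comp _ _ _ (fun z => (x, z))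
  (fun p => (p.1 * p.2)%g)).
  by apply: cvg_pair; [exact: cvg_cst | exact: cvg_id].
exact: mulg_cts.
Qed.

Lemma rtrans_continuous x : continuous (rtrans x).
Proof.
move=> y; apply: (@continuous_comp _ _ _ (fun z => (z, x))
  (fun p => (p.1 * p.2)%g)).
  by apply: cvg_pair; [exact: cvg_id | exact: cvg_cst].
exact: mulg_cts.
Qed.

Definition chart_mul (a b c : chart R n G)
    (p : 'rV[R]_n * 'rV[R]_n) : 'rV[R]_n :=
  c (chart_inv a p.1 * chart_inv b p.2)%g.

(** Smoothness to order 2: the first differential gives the tangent maps of translations, the second
    enters the bracket. *)
Lemma chart_mul_diff2 (a b c : chart R n G) x y :
  atlas a -> atlas b -> atlas c ->
  chart_dom a x -> chart_dom b y -> chart_dom c (x * y)%g ->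
  differentiable (chart_mul a b c) (a x, b y) /\
  forall v, differentiable (fun p => 'd (chart_mul a b c) p v) (a x, b y).
Proof.
move=> aa ab ac ax bx cxy; have [d1 dd] := mulg_smooth a b c aa ab ac 2.
have h : [/\ chart_img a (a x), chart_img b (b y) &
    chart_dom c (chart_inv a (a x) * chart_inv b (b y))%g].
  by split; [exact: chart_img_map..|rewrite !chart_invK].
by split=> [|v]; [exact: d1 | have [+ _] := dd v; exact].
Qed.

(** Left translation is the group law with its first argument frozen; the chart [a] enters only
    through the constant [a x]. *)
Lemma ltrans_diff (a b c : chart R n G) x y v :
  atlas a -> atlas b -> atlas c ->
  chart_dom a x -> chart_dom b y -> chart_dom c (x * y)%g ->
  differentiable (c \o ltrans x \o chart_inv b) (b y) /\
  'd (c \o ltrans x \o chart_inv b) (b y) v =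
  'd (chart_mul a b c) (a x, b y) (0, v).
Proof.
move=> aa ab ac ax bx cxy; have [dm _] := chart_mul_diff2 aa ab ac ax bx cxy.
have [dp dpE] := is_diff_cst_pair (a x) (b y).
have -> : c \o ltrans x \o chart_inv b = chart_mul a b c \o (fun u => (a x, u)).
  by apply/funext => u; rewrite /chart_mul/= chart_invK.
split; first exact: differentiable_comp.
by rewrite diff_compE// dpE.
Qed.

Lemma rtrans_diff (a b c : chart R n G) x y v :
  atlas a -> atlas b -> atlas c ->
  chart_dom a y -> chart_dom b x -> chart_dom c (y * x)%g ->
  differentiable (c \o rtrans x \o chart_inv a) (a y) /\
  'd (c \o rtrans x \o chart_inv a) (a y) v =
  'd (chart_mul a b c) (a y, b x) (v, 0).
Proof.
move=> aa ab ac ay bx cxy; have [dm _] := chart_mul_diff2 aa ab ac ay bx cxy.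
have [dp dpE] := is_diff_pair_cst (b x) (a y).
have -> : c \o rtrans x \o chart_inv a = chart_mul a b c \o (fun u => (u, b x)).
  by apply/funext => u; rewrite /chart_mul/= chart_invK.
split; first exact: differentiable_comp.
by rewrite diff_compE// dpE.
Qed.

(** Chain rule for the composite of translations by [x] and its inverse, which is the identity.
    Naming the product [y] by an equation lets the lemma serve both at [x * 1 = x] and at
    [x^-1 * x = 1]. *)
Lemma tangent_map_ltransK x y z v : (x * z = y)%g ->
  tangent_map (ltrans x^-1%g) y (tangent_map (ltrans x) z v) = v.
Proof.
move=> <-; rewrite /tangent_map.
have -> : ltrans x^-1%g (x * z)%g = z by rewrite /ltrans mulKg.
have [d1 _] := @ltrans_diff _ _ _ x z 0 (chart_at_atlas x) (chart_at_atlas z)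
  (chart_at_atlas (x * z)%g) (chart_at_dom _) (chart_at_dom _) (chart_at_dom _).
have [] := @ltrans_diff _ _ _ x^-1%g (x * z)%g 0 (chart_at_atlas x^-1%g)
  (chart_at_atlas (x * z)%g) (chart_at_atlas z)
  (chart_at_dom _) (chart_at_dom _) _.
  by rewrite mulKg; exact: chart_at_dom.
move=> d2 _.
rewrite -(@diff_chart_comp _ _ G G G (ltrans x))//;
  [|exact: chart_at_dom..|exact: ltrans_continuous].
have -> : ltrans x^-1%g \o ltrans x = id.
  by apply/funext => u; rewrite /ltrans /= mulKg.
by rewrite diff_chart_id//; exact: chart_at_dom.
Qed.

End Translations.

(** * The adjoint representation and its skewness *)

Lemma linear_antisymmetrization {R : pzRingType} (V W : lmodType R)
    (f b : V -> V -> W) :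
  (forall u v, f u v = b u v - b v u) ->
  (forall v, linear (b ^~ v)) -> (forall u, linear (b u)) ->
  (forall v, linear (f ^~ v)) /\ (forall u, linear (f u)).
Proof.
move=> fE bl br; split=> [v a u u'|u a v v'];
  by rewrite !fE bl br scalerBr opprD addrACA.
Qed.

Section AdjointRepresentation.
Context {R : realType} {n : nat} {G : lieGroupType R n}.

Let c : chart R n G := chart_at 1%g.
Let u0 : 'rV[R]_n := c 1%g.
Let mu := chart_mul c c c.

Let ca : atlas c. Proof. exact: chart_at_atlas. Qed.
Let c1 : chart_dom c 1%g. Proof. exact: chart_at_dom. Qed.

(** Near [(u0, u0)] both factors stay in the chart, and so does their product by continuity.
    Differentiability on a neighbourhood is what symmetry of second derivatives requires. *)
Let mu_diff : \forall p \near (u0, u0), differentiable mu p.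
Proof.
have img1 : \forall p \near (u0, u0), chart_img c p.1.
  by apply: (@cvg_fst _ _ _ _ _); exact: near_chart_img.
have img2 : \forall p \near (u0, u0), chart_img c p.2.
  by apply: (@cvg_snd _ _ _ _ _); exact: near_chart_img.
have mulc : (fun p => (chart_inv c p.1 * chart_inv c p.2)%g) @ (u0, u0) -->
    (1 * 1 : G)%g.
  have cc : (fun p => (chart_inv c p.1, chart_inv c p.2)) @ (u0, u0) -->
      ((1, 1) : G * G)%g.
    apply: cvg_pair; apply: cvg_comp (chart_inv_continuous c1).
      exact: cvg_fst.
    exact: cvg_snd.
  exact: cvg_comp cc (@mulg_cts _ _ G (1, 1)%g).
have dom : \forall p \near (u0, u0),
    chart_dom c (chart_inv c p.1 * chart_inv c p.2)%g.
  apply: mulc; rewrite mulg1; apply: open_nbhs_nbhs; split => //.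
  exact: chart_dom_open.
near=> p; have /chart_img_inv[d1 e1] : chart_img c p.1 by near: p.
have /chart_img_inv[d2 e2] : chart_img c p.2 by near: p.
have d12 : chart_dom c (chart_inv c p.1 * chart_inv c p.2)%g by near: p.
have [+ _] := chart_mul_diff2 ca ca ca d1 d2 d12.
by rewrite e1 e2 -surjective_pairing.
Unshelve. all: by end_near. Qed.

Let mu_diff2 v : differentiable (fun p => 'd mu p v) (u0, u0).
Proof.
have [|_ +] := chart_mul_diff2 ca ca ca c1 c1; last exact.
by rewrite mulg1.
Qed.

(** [tangent_map] answers in [chart_at x], while [mu] takes values in the chart [c] at the identity.
    The chain rule with the identity as second map supplies the change of chart. *)
Let tangent_ltrans x v : chart_dom c x ->
  tangent_map (ltrans x) 1%g v = of_chart c x ('d mu (c x, u0) (0, v)).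
Proof.
move=> cx; rewrite /tangent_map -/c.
have E : ltrans x 1%g = x by rewrite /ltrans mulg1.
have [|d1 <-] := ltrans_diff v ca ca ca cx c1; first by rewrite mulg1.
have /(_ v c1) := @diff_chart_comp R n G G G (ltrans x) id 1%g c c (chart_at x).
rewrite E => /(_ cx (@ltrans_continuous _ _ _ x _) d1); apply.
apply: transition_differentiable => //; first exact: chart_at_atlas.
exact: chart_at_dom.
Qed.

Let tangent_rtrans x v : chart_dom c x ->
  tangent_map (rtrans x) 1%g v = of_chart c x ('d mu (u0, c x) (v, 0)).
Proof.
move=> cx; rewrite /tangent_map -/c.
have E : rtrans x 1%g = x by rewrite /rtrans mul1g.
have [|d1 <-] := rtrans_diff v ca ca ca c1 cx; first by rewrite mul1g.
have /(_ v c1) := @diff_chart_comp R n G G G (rtrans x) id 1%g c c (chart_at x).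
rewrite E => /(_ cx (@rtrans_continuous _ _ _ x _) d1); apply.
apply: transition_differentiable => //; first exact: chart_at_atlas.
exact: chart_at_dom.
Qed.

Let mu0r v : 'd mu (u0, u0) (0, v) = v.
Proof.
have [|_ <-] := ltrans_diff v ca ca ca c1 c1; first by rewrite mulg1.
have -> : ltrans (1 : G)%g = id by apply/funext => x; rewrite /ltrans mul1g.
exact: diff_chart_id.
Qed.

Let mu0l v : 'd mu (u0, u0) (v, 0) = v.
Proof.
have [|_ <-] := rtrans_diff v ca ca ca c1 c1; first by rewrite mulg1.
have -> : rtrans (1 : G)%g = id by apply/funext => x; rewrite /rtrans mulg1.
exact: diff_chart_id.
Qed.

(** Holds wherever [u] lies in the image of the chart, which is enough to differentiate at [u0]. *)
Let left_vf_near Z : {near u0, (fun u => 'd mu (u, u0) (0, Z)) =1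
  vf_in_chart c (left_invariant_vf Z)}.
Proof.
near=> u; have /chart_img_inv[d e] : chart_img c u.
  by near: u; exact: near_chart_img.
rewrite /vf_in_chart /left_invariant_vf.
rewrite (tangent_ltrans Z d) (to_chartK _ ca d) e; reflexivity.
Unshelve. all: by end_near. Qed.

Let B Y Z : 'rV[R]_n := 'd (fun p => 'd mu p (0, Z)) (u0, u0) (Y, 0).

Let left_vf_diff Y Z : differentiable (fun u => 'd mu (u, u0) (0, Z)) u0 /\
  'd (fun u => 'd mu (u, u0) (0, Z)) u0 Y = B Y Z.
Proof.
have [dp dpE] := is_diff_pair_cst u0 u0; have dm := mu_diff2 (0, Z).
split; first exact: (differentiable_comp dp dm).
have := diff_compE Y dp dm; rewrite dpE; apply.
Qed.

(** At [u0] a left-invariant field has its generator as coordinates, and its derivative there is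
    given by [B]. *)
Let adE Y Z : ad G Y Z = B Y Z - B Z Y.
Proof.
have V0 X : vf_in_chart c (left_invariant_vf X) u0 = X.
  by rewrite -(nbhs_singleton (left_vf_near X)) mu0r.
have dV X X' : 'd (vf_in_chart c (left_invariant_vf X)) u0 X' = B X' X.
  have [d <-] := left_vf_diff X' X; apply: near_eq_diffE d.
  exact: left_vf_near.
have dVV X X' : 'd (vf_in_chart c (left_invariant_vf X)) u0
    (vf_in_chart c (left_invariant_vf X') u0) = B X' X.
  by rewrite V0 dV.
exact (f_equal2 (fun v w => v - w) (dVV Z Y) (dVV Y Z)).
Qed.

Let B_linearl Z : linear (B ^~ Z).
Proof.
move=> a Y Y'; rewrite /B -linearZ -linearD; congr ('d _ _ _).
by apply/pair_equal_spec; rewrite /= scaler0 addr0.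
Qed.

Let B_linearr Y : linear (B Y).
Proof.
move=> a Z Z'; rewrite /B.
have -> : (fun p => 'd mu p (0, a *: Z + Z')) =
    a *: (fun p => 'd mu p (0, Z)) + (fun p => 'd mu p (0, Z')).
  apply/funext => p; rewrite -[RHS]/(a *: 'd mu p (0, Z) + 'd mu p (0, Z')).
  rewrite -linearZ -linearD; congr ('d _ _ _).
  by apply/pair_equal_spec; rewrite /= scaler0 addr0.
exact: diffPE.
Qed.

Lemma ad_linearl Z : linear (ad G ^~ Z).
Proof.
by have [+ _] := linear_antisymmetrization adE B_linearl B_linearr; exact.
Qed.

Lemma ad_linearr Y : linear (ad G Y).
Proof.
by have [_ +] := linear_antisymmetrization adE B_linearl B_linearr; exact.
Qed.

Lemma ad_self Y : ad G Y Y = 0.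
Proof. exact: eq_trans (adE Y Y) (subrr _). Qed.

(** Symmetry of second derivatives is available for real-valued functions, so it is applied to each
    coordinate [nu] of [mu]. *)
Let B_swap Y Z : 'd (fun p => 'd mu p (Z, 0)) (u0, u0) (0, Y) = B Z Y.
Proof.
apply/rowP => k.
pose nu p := mu p 0 k.
have coordE (f : 'rV[R]_n * 'rV[R]_n -> 'rV[R]_n) p v : differentiable f p ->
    differentiable (fun q => f q 0 k) p /\
    'd (fun q => f q 0 k) p v = 'd f p v 0 k.
  move=> df; have dk := @differentiable_coord R 1 n (f p) 0 k.
  split; first exact: (differentiable_comp df dk).
  rewrite -!deriveE//; last exact: (differentiable_comp df dk).
  by rewrite derive_mx ?mxE//; exact: diff_derivable.
have nu_near v : {near (u0, u0),
    (fun p => 'd mu p v 0 k) =1 (fun p => 'd nu p v)}.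
  by near=> p; have [|_ ->//] := coordE mu p v; near: p.
have nu2 v w : differentiable (fun p => 'd nu p v) (u0, u0) /\
    'd (fun p => 'd nu p v) (u0, u0) w = 'd (fun p => 'd mu p v) (u0, u0) w 0 k.
  have [d <-] := coordE _ _ w (mu_diff2 v); split.
    by apply: near_eq_differentiable d; exact: nu_near.
  by apply: near_eq_diffE d; exact: nu_near.
have [d1 <-] := nu2 (Z, 0) (0, Y); rewrite /B.
have [d2 <-] := nu2 (0, Y) (Z, 0).
apply: diff2_sym => //.
by near=> p; have [|//] := coordE mu p 0; near: p.
Unshelve. all: by end_near. Qed.

(* Near the identity the metric, read in a chart, gives the same value on the
   left and on the right translates of Z and W; differentiating this equality
   along Y at the identity cancels the derivative of the metric itself. *)
Lemma ad_skew (m : riemannianMetric G) Y Z W : bi_invariant m ->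
  m 1%g (ad G Y Z) W + m 1%g Z (ad G Y W) = 0.
Proof.
move=> mbi.
pose ofc := of_chart c.
pose h u v w :=
  m (chart_inv c u) (ofc (chart_inv c u) v) (ofc (chart_inv c u) w).
have h0 v w : h u0 v w = m 1%g v w.
  have o1 v' : ofc 1%g v' = v' by exact: diff_chart_id.
  by rewrite /h /u0 chart_invK// !o1.
pose line (s : R) := u0 + s *: Y.
have line0 : line 0 = u0 by rewrite /line scale0r addr0.
have lineE : is_derive (0 : R) 1 line Y by exact: is_derive1_line.
have line_img : \forall s \near (0 : R), chart_img c (line s).
  have lc : {for (0 : R), continuous line}.
    by apply: differentiable_continuous; apply/derivable1_diffP; case: lineE.
  by apply: lc; rewrite line0; exact: near_chart_img.
have hE v w : exists d, is_derive (0 : R) 1 (fun s => h (line s) v w) d.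
  exists ('d (fun u => h u v w) u0 Y).
  apply: (@is_derive1_comp_diff _ _ _ (fun u => h u v w) _ _ _ _ lineE line0).
  have [+ _] := metric_smooth m ca v w 1; apply.
  exact: chart_img_map.
(* By [hE] the derivative exists, so the default 0 of [xget] is never taken. *)
pose dh v w := xget 0 [set d | is_derive (0 : R) 1 (fun s => h (line s) v w) d].
have dhE v w : is_derive (0 : R) 1 (fun s => h (line s) v w) (dh v w).
  by rewrite /dh; case: xgetP => [d -> //|]; have [d hd] := hE v w => /(_ d).
have hl s w : linear (h (line s) ^~ w : _ -> R^o).
  by move=> a v v'; rewrite /h /ofc /of_chart linearP metric_linear.
have hr s w : linear (h (line s) w : _ -> R^o).
  move=> a v v'; rewrite /h /ofc /of_chart linearP.
  exact: metric_linearr.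
(* Coordinates of the left and right translates of [X] to the point [line s]; both equal [X] at
   [s = 0]. *)
pose l X (s : R) := 'd mu (line s, u0) (0, X).
pose r X (s : R) := 'd mu (u0, line s) (X, 0).
have l0 X : l X 0 = X by rewrite /l line0 mu0r.
have r0 X : r X 0 = X by rewrite /r line0 mu0l.
have lE X : is_derive (0 : R) 1 (l X) (B Y X).
  have [d <-] := left_vf_diff Y X.
  exact: is_derive1_comp_diff lineE line0 d.
have rE X : is_derive (0 : R) 1 (r X) (B X Y).
  have [dp dpE] := is_diff_cst_pair u0 u0; have dm := mu_diff2 (X, 0).
  rewrite -B_swap.
  have <- : 'd (fun u => 'd mu (u0, u) (X, 0)) u0 Y =
      'd (fun p => 'd mu p (X, 0)) (u0, u0) (0, Y).
    have := diff_compE Y dp dm; rewrite dpE; apply.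
  have d := differentiable_comp dp dm.
  exact: is_derive1_comp_diff lineE line0 d.
(* By bi-invariance both sides equal the inner product of [Z] and [W] at the identity. *)
have lrn : {near (0 : R), (fun s => h (line s) (l Z s) (l W s)) =1
    (fun s => h (line s) (r Z s) (r W s))}.
  near=> s; have /chart_img_inv[d e] : chart_img c (line s) by near: s.
  have [lm _] := mbi (chart_inv c (line s)) 1%g Z W.
  have [_ rm] := mbi (chart_inv c (line s)) 1%g Z W.
  rewrite !tangent_ltrans// e /ltrans mulg1 in lm.
  rewrite !tangent_rtrans// e /rtrans mul1g in rm.
  by rewrite /h /l /r /ofc lm rm.
have hlE := is_derive_bilin_form hl hr dhE (lE Z) (lE W).
have hrE := is_derive_bilin_form hl hr dhE (rE Z) (rE W).
have [_ v1] := near_eq_is_derive lrn hlE; have [_ v2] := hrE.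
(* The translates agree at 0, so both derivatives contain the same double sum in [dh], which [addIr]
   removes. *)
have := eq_trans (esym v1) v2; rewrite !l0 !r0 !line0 => /addIr.
rewrite !h0 !adE => E.
rewrite (metricBl m 1%g (B Y Z)) (metricBr m 1%g (B Y W)).
move: (m 1%g (B Y Z) W) (m 1%g Z (B Y W)) (m 1%g (B Z Y) W) (m 1%g Z (B W Y)) E.
by move=> p1 p2 q1 q2 E; rewrite addrACA E -opprD subrr.
Unshelve. all: by end_near. Qed.

(** Paired with [Z], the left side is the inner product of [sharp m xi] with [[Y, Z]]; skewness
    moves the bracket over and produces the sign. *)
Lemma sharp_coad (m : riemannianMetric G) Y xi : bi_invariant m ->
  sharp m (coad G Y xi) = - ad G Y (sharp m xi).
Proof.
move=> mbi; apply: (@metric_inj _ _ _ m 1%g) => Z.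
rewrite metric_sharp metricNl.
(* [coad] records values on basis vectors only; linearity of [ad G Y] extends the formula to every
   [Z]. *)
have -> : ev (coad G Y xi) Z = ev xi (ad G Y Z).
  pose adL : {linear 'rV[R]_n -> 'rV[R]_n} :=
    HB.pack (ad G Y) (GRing.isLinear.Build _ _ _ _ _ (ad_linearr Y)).
  rewrite /ev -[ad G Y Z]/(adL Z) {2}(row_sum_delta Z) linear_sum mulmx_suml.
  rewrite summxE mxE; apply: eq_bigr => i _.
  by rewrite linearZ/= -scalemxAl !mxE /ev mxE.
rewrite -(metric_sharp m); apply/eqP; rewrite -addr_eq0 addrC; apply/eqP.
exact: ad_skew.
Qed.

End AdjointRepresentation.

(** * From the Hamiltonian system to the third-order equation and back *)

Lemma eq_derive1 {R : realType} (W : normedModType R) (J : set R) (f g : R -> W)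
    (t : R) dg : open J -> J t -> (forall s, J s -> f s = g s) ->
  is_derive t 1 g dg -> derive1 f t = dg.
Proof.
move=> Jo Jt fg [_ <-]; rewrite derive1E; apply: near_eq_derive.
by near=> s; apply: fg; near: s; exact: open_nbhs_nbhs.
Unshelve. all: by end_near. Qed.

Section Equations.
Context {R : realType} {n : nat} {G : lieGroupType R n}.
Variables (m : riemannianMetric G) (J : set R).
Variables (Y : R -> 'rV[R]_n) (mu xi : R -> 'cV[R]_n).
Hypotheses (J_open : open J) (Y_smooth : smooth_on J Y).
Hypotheses (mu_smooth : smooth_on J mu) (xi_smooth : smooth_on J xi).
Hypothesis YE : forall t, J t -> derive1 Y t = sharp m (xi t).

Lemma derive2_sharp t : J t -> derive1n 2 Y t = sharp m (derive1 xi t).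
Proof.
move=> Jt; apply: (eq_derive1 J_open Jt YE).
by apply: is_derive_sharp; exact: smooth_on_is_derive.
Qed.

(** Serves both directions: [mu' = 0] yields the third-order equation, and that equation yields
    [mu' = 0]. *)
Lemma derive3_ad t :
  (forall s, J s ->
    derive1n 2 Y s = - sharp m (mu s) - ad G (Y s) (derive1 Y s)) ->
  J t ->
  derive1n 3 Y t + ad G (Y t) (derive1n 2 Y t) = - sharp m (derive1 mu t).
Proof.
move=> Y2 Jt.
have YD : is_derive t 1 Y (derive1 Y t) by exact: smooth_on_is_derive.
have Y'D : is_derive t 1 (derive1 Y) (derive1n 2 Y t).
  by apply: (@smooth_on_is_derive _ _ J) => //; exact: smooth_on_derive1.
have muD : is_derive t 1 (fun s => sharp m (mu s)) (sharp m (derive1 mu t)).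
  by apply: is_derive_sharp; exact: smooth_on_is_derive.
have adD := is_derive_bilin_mx (@ad_linearl _ _ G) (@ad_linearr _ _ G) YD Y'D.
(* The product rule gives [[Y', Y'] + [Y, Y'']], whose first term vanishes. *)
rewrite ad_self add0r in adD.
have /= -> := eq_derive1 J_open Jt Y2 (is_deriveB (is_deriveN muD) adD).
by rewrite subrK.
Qed.

End Equations.

Theorem mainTheorem2 (R : realType) (n : nat) (G : lieGroupType R n)
    (G_compact : compact [set: G]) (G_connected : connected [set: G])
    (m : riemannianMetric G) (m_bi : bi_invariant m)
    (J : set R) (J_open : open J) (J_itv : is_interval J)
    (x : R -> G) (Y : R -> 'rV[R]_n) (mu xi : R -> 'cV[R]_n) :
  (solution_H m J x Y mu xi -> solution_EL J x Y) /\
  (solution_EL J x Y -> smooth_on J xi -> smooth_on J mu ->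
   (forall t, J t ->
      derive1 Y t = sharp m (xi t) /\
      derive1 (fun s => sharp m (xi s)) t + sharp m (mu t)
        + ad G (Y t) (sharp m (xi t)) = 0) ->
   solution_H m J x Y mu xi).
Proof.
split.
  move=> [[x_smooth Y_smooth mu_smooth xi_smooth] H]; split=> // t Jt.
  have YE s : J s -> derive1 Y s = sharp m (xi s) by move=> /H[].
  have [velE _ mu0 _] := H t Jt; split.
    by rewrite velE tangent_map_ltransK// mulg1.
  rewrite (derive3_ad (m := m) (mu := mu) J_open Y_smooth mu_smooth _ Jt).
    by rewrite mu0 sharp0 oppr0.
  move=> s Js; rewrite (derive2_sharp J_open xi_smooth YE Js).
  have [_ -> _ ->] := H s Js.
  by rewrite sharpD sharpN sharp_coad.
move=> [x_smooth Y_smooth EL] xi_smooth mu_smooth H; split=> // t Jt.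
have YE s : J s -> derive1 Y s = sharp m (xi s) by move=> /H[].
(* The hypothesis on [X_xi], once the time derivative is moved inside the linear map [sharp m]. *)
have sharp_xi s : J s ->
    sharp m (derive1 xi s) = - sharp m (mu s) - ad G (Y s) (sharp m (xi s)).
  move=> Js; have [_] := H s Js; rewrite derive1E.
  have [_ ->] := is_derive_sharp m (smooth_on_is_derive xi_smooth Js).
  by rewrite -addrA => /eqP; rewrite addr_eq0 opprD => /eqP.
have [YvelE EL3] := EL t Jt; split.
(* The roles of [x t] and its inverse are exchanged, so that translation by [x t] undoes the one in
   (EL). *)
- have := @tangent_map_ltransK _ _ G (x t)^-1%g 1%g (x t) (velocity x t).
  by rewrite invgK -YvelE => -> //; rewrite mulVg.
- exact: YE.
(* The left side of (EL) is [- sharp m (derive1 mu t)], so its vanishing forces [mu' = 0] by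
   injectivity. *)
- apply: (@sharp_inj _ _ _ m); rewrite sharp0; apply: oppr_inj; rewrite oppr0.
  rewrite -EL3; apply/esym; apply: (derive3_ad J_open) => // s Js.
  by rewrite (derive2_sharp J_open xi_smooth YE Js) sharp_xi// YE.
- apply: (@sharp_inj _ _ _ m).
  by rewrite sharp_xi// sharpD sharpN sharp_coad.
Qed.
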